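(* Let $R$ be a commutative ring, let $A$ be an $R$-algebra of finite cardinality and let $f:A\to B$ be an epimorphism (surjective homomorphism) of $R$-algebras. For any natural number $k$ there is a non-negative integer $g_k(A,B)$ with the following property: any sequence $b_1,\dots,b_k$ of $k$ elements generating the $R$-algebra $B$ can be lifted to exactly $g_k(A,B)$ sequences of $k$ generators of $A$; that is, there are exactly $g_k(A,B)$ sequences $a_1,\dots,a_k$ of elements generating $A$ as an $R$-algebra such that $f(a_i)=b_i$ for $i=1,\dots,k$.
   Context: Algebras are associative with identity, subalgebras contain the identity, and homomorphisms preserve it. Elements $a_1,\dots,a_k$ generate an $R$-algebra $A$ if the smallest (unital) $R$-subalgebra of $A$ containing them is $A$. *)

(* Defs.v *)
From HB Require Import structures.
From mathcomp Require Import all_boot all_order all_algebra.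
From mathcomp Require Import boolp classical_sets.
Set Implicit Arguments.
Unset Strict Implicit.
Unset Printing Implicit Defensive.
Import GRing.Theory.
Local Open Scope ring_scope.
Local Open Scope classical_set_scope.

(* MathComp's [algType R] requires 1 != 0 in the algebra, which would exclude
   the zero algebra.  [algebra_on R A] has the axioms of
   [algType R] on a ring A that may be zero: the R-module axioms and the
   compatibility of scaling with both sides of the product.  *)
Record algebra_on (R : comPzRingType) (A : pzRingType) := AlgebraOn {
  ascale : R -> A -> A;
  ascaleA : forall r s x, ascale r (ascale s x) = ascale (r * s) x;
  ascale1 : forall x, ascale 1 x = x;
  ascaleDr : forall r x y, ascale r (x + y) = ascale r x + ascale r y;
  ascaleDl : forall r s x, ascale (r + s) x = ascale r x + ascale s x;
  ascaleAl : forall r x y, ascale r (x * y) = ascale r x * y;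
  ascaleAr : forall r x y, ascale r (x * y) = x * ascale r y
}.

Section Algebras.
Variables (R : comPzRingType) (A : pzRingType) (algA : algebra_on R A).

(* The same closure conditions as [GRing.subalg_closed].  *)
Definition is_subalgebra (S : set A) : Prop :=
  [/\ S 1,
      forall r x y, S x -> S y -> S (ascale algA r x + y)
    & forall x y, S x -> S y -> S (x * y)].

Definition generates (k : nat) (a : k.-tuple A) : Prop :=
  smallest is_subalgebra [set` a] = [set: A].

End Algebras.

Definition algebra_morphism (R : comPzRingType) (A B : pzRingType)
    (algA : algebra_on R A) (algB : algebra_on R B)
    (f : {rmorphism A -> B}) : Prop :=
  forall r x, f (ascale algA r x) = ascale algB r (f x).

(* Main.v *)
Require Import Defs.
From HB Require Import structures.
From mathcomp Require Import all_boot all_order all_algebra.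
From mathcomp Require Import boolp classical_sets.
Set Implicit Arguments.
Unset Strict Implicit.
Unset Printing Implicit Defensive.
Import GRing.Theory.
Local Open Scope ring_scope.

(** Call a subset [S] of [A] full when it is a subalgebra with [f(S) = B].
    For a full [S], the number of lifts of [b] with all entries in [S] does
    not depend on [b]: translating by a tuple of [S] that lifts [b' - b]
    carries the lifts of [b] injectively to those of [b'] ([leq_card_liftsin]).
    Sorting these lifts by the subalgebra [T] that they generate writes their
    number as the sum over [T \subset S] of the number of lifts of [b] that
    generate exactly [T] ([card_liftsin]).  The terms with [T] proper are
    independent of [b] by induction on the cardinality of [S], hence so is the
    term [T = S] ([card_liftsgen_eq]).  If [S] is not full, no lift of a
    generating tuple generates it, because the image of the subalgebra
    generated by a lift is a subalgebra containing [b] ([gensub_onto]).  The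
    theorem is the case [S = A].  This is Gaschutz's counting argument for
    lifting generators of finite groups, transposed to algebras. *)

Section GeneratedSubalgebra.
Variables (R : comPzRingType) (A : pzRingType) (algA : algebra_on R A).

Lemma is_subalgebra_smallest (G : set A) :
  is_subalgebra algA (smallest (is_subalgebra algA) G).
Proof.
split=> [S [[S1 _ _] _]|r x y Sx Sy S SG|x y Sx Sy S SG] //.
- by case: (SG) => -[_ Sl _] _; apply: Sl; [apply: Sx|apply: Sy].
- by case: (SG) => -[_ _ Sm] _; apply: Sm; [apply: Sx|apply: Sy].
Qed.

Lemma is_subalgebraD (S : set A) x y :
  is_subalgebra algA S -> S x -> S y -> S (x + y).
Proof. by case=> _ Sl _ Sx Sy; rewrite -[x](ascale1 algA); apply: Sl. Qed.

Lemma is_subalgebra_image (B : pzRingType) (algB : algebra_on R B)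
    (f : {rmorphism A -> B}) (S : set A) :
  algebra_morphism algA algB f -> is_subalgebra algA S ->
  is_subalgebra algB (f @` S)%classic.
Proof.
move=> f_alg [S1 Sl Sm]; split; first by exists 1; rewrite ?rmorph1.
- move=> r _ _ [x Sx <-] [y Sy <-]; exists (ascale algA r x + y); first exact: Sl.
  by rewrite rmorphD f_alg.
- by move=> _ _ [x Sx <-] [y Sy <-]; exists (x * y); [apply: Sm|rewrite rmorphM].
Qed.

End GeneratedSubalgebra.

Section CountingLifts.
Variables (R : comPzRingType) (A : finPzRingType) (B : pzRingType).
Variables (algA : algebra_on R A) (algB : algebra_on R B).
Variables (f : {rmorphism A -> B}) (k : nat).
Implicit Types (a : k.-tuple A) (b : k.-tuple B) (S T : {set A}).

Definition gensub a : {set A} :=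
  [set x | `[< smallest (is_subalgebra algA) [set` a] x >]].

Definition lifts b a := [forall i, f (tnth a i) == tnth b i].

Definition liftsin S b : {set k.-tuple A} :=
  [set a | lifts b a & [forall i, tnth a i \in S]].

Definition liftsgen S b : {set k.-tuple A} :=
  [set a | lifts b a & gensub a == S].

Definition full S : Prop :=
  is_subalgebra algA [set` S] /\ forall y, exists2 x, x \in S & f x = y.

Lemma is_subalgebra_gensub a : is_subalgebra algA [set` gensub a].
Proof.
suff -> : [set` gensub a]%classic = smallest (is_subalgebra algA) [set` a].
  exact: is_subalgebra_smallest.
by apply/seteqP; split=> x /=; rewrite inE => /asboolP.
Qed.

Lemma gensub_sub a S : is_subalgebra algA [set` S] ->
  (gensub a \subset S) = [forall i, tnth a i \in S].
Proof.
move=> algS; apply/idP/forallP => [/fintype.subsetP aS i | aS].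
  apply: aS; rewrite inE; apply/asboolP => T [_ aT].
  by apply: aT; apply: mem_tnth.
apply/fintype.subsetP => x; rewrite inE => /asboolP/(_ [set` S]%classic); apply.
split=> // _ /tnthP[i ->].
exact: aS.
Qed.

Lemma generatesE a : generates algA a <-> gensub a = [set: A]%SET.
Proof.
split=> [aA | aA].
  by apply/setP => x; rewrite !inE; apply/asboolP; rewrite aA.
apply/seteqP; split=> // x _.
have: x \in gensub a by rewrite aA inE.
by rewrite inE => /asboolP.
Qed.

(** The image of the subalgebra generated by [a] is a subalgebra containing
    every entry of [b], so it is everything as soon as [b] generates [B]. *)
Lemma gensub_onto a b : algebra_morphism algA algB f -> generates algB b ->
  lifts b a -> forall y, exists2 x, x \in gensub a & f x = y.
Proof.
move=> f_alg b_gen /forallP ab y.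
have : smallest (is_subalgebra algB) [set` b] y by rewrite b_gen.
case/(_ (f @` [set` gensub a])%classic) => [|x xa <-]; last by exists x.
split; first exact/is_subalgebra_image/is_subalgebra_gensub.
move=> _ /tnthP[i ->]; exists (tnth a i); last exact/eqP/ab.
by move: i; apply/forallP; rewrite -gensub_sub //; apply: is_subalgebra_gensub.
Qed.

(** Surjectivity of [f] on [S] supplies a tuple [d] of [S] lifting [b' - b];
    adding [d] is an injection, with values in [S] because [S] is closed under
    addition.  Exchanging [b] and [b'] gives equality. *)
Lemma leq_card_liftsin S b b' : full S -> (#|liftsin S b| <= #|liftsin S b'|)%N.
Proof.
move=> [algS S_onto].
have /fin_all_exists2[d dS fd] i :
  exists2 x, x \in S & f x = tnth b' i - tnth b i by apply: S_onto.
pose shift a : k.-tuple A := [tuple tnth a i + d i | i < k].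
have shift_inj : injective shift.
  move=> a a' aa'; apply: eq_from_tnth => i; apply: (@addIr _ (d i)).
  have := congr1 (fun t : k.-tuple A => tnth t i) aa'.
  by rewrite !tnth_mktuple.
rewrite -(card_imset _ shift_inj); apply: fintype.subset_leq_card.
apply/fintype.subsetP => _ /imsetP[a aL ->]; move: aL.
rewrite !inE => /andP[/forallP ab /forallP aS].
apply/andP; split; apply/forallP => i; rewrite tnth_mktuple.
  by rewrite rmorphD (eqP (ab i)) fd addrC subrK.
exact: (is_subalgebraD algS (aS i) (dS i)).
Qed.

(** The entries of [a] lie in a subalgebra [S] exactly when [gensub a] is
    contained in [S]; the lifts in [S] are sorted by the value of [gensub]. *)
Lemma card_liftsin S b : is_subalgebra algA [set` S] ->
  #|liftsin S b| = (\sum_(T : {set A} | T \subset S) #|liftsgen T b|)%N.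
Proof.
move=> algS; rewrite -sum1_card (partition_big gensub (fun T => T \subset S)) /=.
  apply: eq_bigr => T TS; rewrite -sum1_card; apply: eq_bigl => a.
  rewrite !inE -gensub_sub // -andbA; congr andb.
  by case: eqP => [->|]; rewrite ?TS ?andbF.
by move=> a; rewrite inE gensub_sub // => /andP[].
Qed.

Lemma liftsgen_full S b a : algebra_morphism algA algB f ->
  generates algB b -> a \in liftsgen S b -> full S.
Proof.
move=> f_alg b_gen; rewrite inE => /andP[ab /eqP <-].
by split; [apply: is_subalgebra_gensub|apply: gensub_onto b_gen ab].
Qed.

(** Strong induction on the cardinality of [S].  For full [S] the two totals
    over all [T \subset S] agree, and by induction so do their terms with
    [T] proper; cancelling these leaves the terms [T = S]. *)
Lemma card_liftsgen_eq S b b' : algebra_morphism algA algB f ->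
  generates algB b -> generates algB b' -> #|liftsgen S b| = #|liftsgen S b'|.
Proof.
move=> f_alg b_gen b'_gen; have [n] := ubnP #|S|.
elim: n S => // n IHn S; rewrite ltnS => leSn.
case: (pselect (full S)) => [fullS | notfull]; last first.
  have empty c : generates algB c -> #|liftsgen S c| = 0%N.
    move=> c_gen; apply: eq_card0 => a; apply/negP => /liftsgen_full fullS.
    exact/notfull/fullS.
  by rewrite !empty.
have : #|liftsin S b| = #|liftsin S b'|.
  by apply/eqP; rewrite eqn_leq !leq_card_liftsin.
case: (fullS) => algS _; rewrite !card_liftsin // (bigD1 S) //= [in RHS](bigD1 S) //=.
rewrite [X in (_ + X)%N = _](eq_bigr (fun T => #|liftsgen T b'|)) => [/addIn //|T].
rewrite andbC -finset.properEneq => /fintype.proper_card ltTS.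
exact/IHn/(leq_trans ltTS).
Qed.

End CountingLifts.

Theorem theorem2p3 (R : comPzRingType) (A : finPzRingType) (B : pzRingType)
    (algA : algebra_on R A) (algB : algebra_on R B)
    (f : {rmorphism A -> B}) (f_alg : algebra_morphism algA algB f)
    (f_surj : forall y : B, exists x : A, f x = y) (k : nat) :
  exists g : nat, forall b : k.-tuple B, generates algB b ->
    #|[pred a : k.-tuple A |
        `[< generates algA a /\ forall i : 'I_k, f (tnth a i) = tnth b i >]]| = g.
Proof.
have countE (b : k.-tuple B) :
  #|[pred a : k.-tuple A |
      `[< generates algA a /\ forall i : 'I_k, f (tnth a i) = tnth b i >]]|
  = #|liftsgen algA f [set: A]%SET b|.
  apply: eq_card => a; rewrite !inE; apply/asboolP/andP.
    case=> /generatesE/eqP-> ab; split=> //.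
    by apply/forallP => i; rewrite ab.
  case=> /forallP ab /eqP/generatesE a_gen; split=> // i; exact/eqP/ab.
case: (pselect (exists b : k.-tuple B, generates algB b)) => [[b0 b0_gen]|no_gen].
  (* Any generating tuple of B serves as the reference count. *)
  exists #|liftsgen algA f [set: A]%SET b0| => b b_gen.
  by rewrite countE; apply: card_liftsgen_eq b_gen b0_gen.
by exists 0%N => b b_gen; case: no_gen; exists b.
Qed.
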